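(* The language $L_5=\{\omega\in\{a,b,c\}^*:\ \text{exactly one of } |\omega|_a=|\omega|_b \text{ and } |\omega|_a=|\omega|_c \text{ holds}\}$ is recognized by some QPA with probability $\frac47$: there is a QPA which accepts every $x\in L_5$ with probability at least $\frac47$ and rejects every $x\in\{a,b,c\}^*\setminus L_5$ with probability at least $\frac47$.
   Context: $|\omega|_i$ denotes the number of occurrences of the symbol $i$ in $\omega$. A QPA is a tuple $A=(Q,\Sigma,T,q_0,Q_a,Q_r,\delta)$ with $Q$ a finite set of states, $\Sigma$ a finite input alphabet, $T$ a finite stack alphabet, $q_0\in Q$, $Q_a,Q_r\subset Q$ disjoint, $\Gamma=\Sigma\cup\{\#,\$\}$ (end-markers), $\Delta=T\cup\{Z_0\}$ ($Z_0\notin T$ the stack base symbol), and $\delta:Q\times\Gamma\times\Delta\times Q\times\{\downarrow,\to\}\times\Delta^*\to\mathbb{C}$ such that whenever $\delta(q,\alpha,\beta,q',d,\omega)\ne0$: $|\omega|\le2$; if $|\omega|=2$ then $\omega_1=\beta$; if $\beta=Z_0$ then $\omega\in Z_0T^*$; if $\beta\ne Z_0$ then $\omega\in T^*$; and such that the evolution operator $U_A$ is unitary. A configuration is $|\nu_i q_j\nu_k,\omega_l\rangle$ with $q_j\in Q$, $\nu_i\nu_k\in\#\Sigma^*\$$, input head on the first symbol of $\nu_k$, $\omega_l\in Z_0T^*$ the stack with head on its last symbol; $C$ is the set of configurations, $H_A=\ell_2(C)$; for $c=|\nu_i q_j\sigma\nu_k,\omega_l\tau\rangle$, $U_A|c\rangle=\sum_{(q,d,\omega)}\delta(q_j,\sigma,\tau,q,d,\omega)|f(c,d,q),\omega_l\omega\rangle$,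 where $f(c,\downarrow,q)=\nu_i q\sigma\nu_k$, $f(c,\to,q)=\nu_i\sigma q\nu_k$. Recognition: $E_a,E_r,E_n$ are the subspaces spanned by configurations with state in $Q_a$, in $Q_r$, in neither; on input $x$ start in $|q_0\#x\$,Z_0\rangle$, repeatedly apply $U_A$ and measure w.r.t. $E_a\oplus E_r\oplus E_n$, halting on ``accept''/``reject'' and otherwise continuing from the normalized projection onto $E_n$; acceptance/rejection probability is the total probability of eventually halting with that outcome. *)

(* Defs.v *)
From HB Require Import structures.
From mathcomp Require Import all_boot all_order all_algebra.
From mathcomp Require Import complex.
From mathcomp Require Import all_classical all_reals all_analysis.
From mathcomp Require Import Rstruct Rstruct_topology.

Set Implicit Arguments.
Unset Strict Implicit.
Unset Printing Implicit Defensive.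

Import Order.TTheory GRing.Theory Num.Theory.
Local Open Scope ring_scope.

Definition RR : realType := Rdefinitions.R.
Definition CC := RR[i].

Definition sqn (z : CC) : RR := (complex.Re z) ^+ 2 + (complex.Im z) ^+ 2.

Inductive dir := Stay | Move.

Inductive tsym (S : Type) := TSym of S | THash | TDollar.
Arguments THash {S}.
Arguments TDollar {S}.

(* Delta = T ∪ {Z0} is rendered as option T, with None = Z0. *)
Record QPA (Sigma : finType) := {
  qstate : finType;
  qstack : finType;
  q_init : qstate;
  Q_acc : {set qstate};
  Q_rej : {set qstate};
  delta : qstate -> tsym Sigma -> option qstack -> qstate -> dir ->
          seq (option qstack) -> CC }.

Section QPAdefs.
Variable Sigma : finType.
Variable A : QPA Sigma.

Local Notation Q := (qstate A).
Local Notation T := (qstack A).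

(* Configuration |nu_i q nu_k, Z0 w>: (state, head position on #x$, w),
   where position 0 is '#', positions 1..|x| are the letters of x and
   position |x|+1 is '$'; the stack is Z0 w with w : seq T, top = last. *)
Definition config := (Q * nat * seq T)%type.
Definition cst (c : config) : Q := c.1.1.
Definition cpos (c : config) : nat := c.1.2.
Definition cstk (c : config) : seq T := c.2.

Definition valid (x : seq Sigma) (c : config) : bool := (cpos c < size x + 2)%N.

Definition tape_sym (x : seq Sigma) (i : nat) : tsym Sigma :=
  if i == 0 then THash else
  match onth x i.-1 with Some s => TSym s | None => TDollar end.

Definition top (w : seq T) : option T :=
  match rev w with [::] => None | t :: _ => Some t end.

Definition next_cfg (c : config) (q' : Q) (d : dir) (om : seq (option T))
  : config :=
  (q', (if d is Move then (cpos c).+1 else cpos c),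
   if cstk c is [::] then pmap id (behead om)       (* top was Z0 *)
   else take (size (cstk c)).-1 (cstk c) ++ pmap id om).

Definition words2 : seq (seq (option T)) :=
  [:: [::]] ++ [seq [:: a] | a <- enum {: option T}]
            ++ [seq [:: a; b] | a <- enum {: option T}, b <- enum {: option T}].

(* matrix entry <d| U_A |c> for input x *)
Definition amp (x : seq Sigma) (d c : config) : CC :=
  \sum_(q' : Q) \sum_(m <- [:: Stay; Move]) \sum_(om <- words2)
     (if next_cfg c q' m om == d then
        @delta Sigma A (cst c) (tape_sym x (cpos c)) (top (cstk c)) q' m om
      else 0).

Definition delta_wf : Prop :=
  forall q a b q' m om, @delta Sigma A q a b q' m om != 0 ->
    [/\ (size om <= 2)%N,
        size om = 2%N -> head None om = b,
        b = None -> exists w : seq T, om = None :: map Some w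
      & forall t, b = Some t -> exists w : seq T, om = map Some w].

(* U_A must map configurations to configurations: no right move from '$' *)
Definition no_move_off_tape : Prop :=
  forall q b q' om, @delta Sigma A q TDollar b q' Move om = 0.

(* U_A unitary on l2(C).  U_A preserves the input word, so this is
   unitarity on each block l2(C_x); since every row and column of U_A has
   finite support, this is orthonormality of columns and of rows; the sums
   are taken over any duplicate-free list covering the (finite) support. *)
Definition unitary_U : Prop :=
  forall x : seq Sigma,
  (forall c c' : config, valid x c -> valid x c' ->
     forall s : seq config, uniq s ->
     (forall d, valid x d -> (amp x d c != 0) || (amp x d c' != 0) -> d \in s) ->
     \sum_(d <- s | valid x d) (amp x d c)^* * amp x d c' = (c == c')%:R)
  /\
  (forall d d' : config, valid x d -> valid x d' ->
     forall s : seq config, uniq s ->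
     (forall c, valid x c -> (amp x d c != 0) || (amp x d' c != 0) -> c \in s) ->
     \sum_(c <- s | valid x c) amp x d c * (amp x d' c)^* = (d == d')%:R).

Definition is_QPA : Prop :=
  [disjoint Q_acc A & Q_rej A] /\ delta_wf /\ no_move_off_tape /\ unitary_U.

Definition succs (c : config) : seq config :=
  [seq next_cfg c q' mo.1 mo.2 | q' <- enum Q,
     mo <- [seq (m, om) | m <- [:: Stay; Move], om <- words2]].

Definition step_supp (s : seq config) : seq config :=
  undup (flatten (map succs s)).

(* (U_A phi)(d), phi supported on the duplicate-free list s *)
Definition Uapp (x : seq Sigma) (s : seq config) (phi : config -> CC)
    (d : config) : CC :=
  \sum_(c <- s) amp x d c * phi c.

Definition init_cfg : config := (q_init A, 0%N, [::]).

Definition nonhalting (q : Q) : bool := (q \notin Q_acc A) && (q \notin Q_rej A).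

(* unnormalized non-halting state after n steps (projection onto E_n after
   each application of U_A), together with a list containing its support *)
Fixpoint evol (x : seq Sigma) (n : nat) : seq config * (config -> CC) :=
  match n with
  | 0 => ([:: init_cfg], fun c => (c == init_cfg)%:R)
  | n'.+1 =>
      let (s, phi) := evol x n' in
      (step_supp s,
       fun d => if nonhalting (cst d) then Uapp x s phi d else 0)
  end.

(* probability of halting with "accept" (resp. "reject") at step n+1 *)
Definition p_acc_step (x : seq Sigma) (n : nat) : RR :=
  let (s, phi) := evol x n in
  \sum_(d <- step_supp s | cst d \in Q_acc A) sqn (Uapp x s phi d).

Definition p_rej_step (x : seq Sigma) (n : nat) : RR :=
  let (s, phi) := evol x n in
  \sum_(d <- step_supp s | cst d \in Q_rej A) sqn (Uapp x s phi d).

Definition accept_prob (x : seq Sigma) : \bar RR :=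
  (\sum_(0 <= n <oo) (p_acc_step x n)%:E)%E.

Definition reject_prob (x : seq Sigma) : \bar RR :=
  (\sum_(0 <= n <oo) (p_rej_step x n)%:E)%E.

End QPAdefs.

Definition sigma3 := 'I_3.
Definition la : sigma3 := @Ordinal 3 0 isT.
Definition lb : sigma3 := @Ordinal 3 1 isT.
Definition lc : sigma3 := @Ordinal 3 2 isT.

Definition L5 (w : seq sigma3) : bool :=
  (count_mem la w == count_mem lb w) != (count_mem la w == count_mem lc w).

(* Main.v *)
Require Import Defs.
From HB Require Import structures.
From mathcomp Require Import all_boot all_order all_algebra.
From mathcomp Require Import complex.
From mathcomp Require Import all_classical all_reals all_analysis.
From mathcomp Require Import Rstruct Rstruct_topology.
From mathcomp Require Import ring lra zify.
Import Order.TTheory GRing.Theory Num.Theory.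
Local Open Scope ring_scope.

(** Two copies of a reversible counter machine run in superposition, with
  amplitude [sqrt (2/7)] each: copy 0 keeps |w|_a - |w|_b and copy 1 keeps
  |w|_a - |w|_c, as a sign in the state and a unary stack. The remaining
  probability 3/7 is accepted at once. At [$] a copy whose counter is nonzero
  rejects, while a copy whose counter is zero passes through a balanced
  beam splitter into one accepting and one rejecting output. If both counters
  are zero the two copies interfere and all of their weight 4/7 is rejected; if
  neither is zero, again 4/7 is rejected; if exactly one is zero, its weight 2/7
  is split evenly and the acceptance probability is 3/7 + 1/7.

  The evolution is unitary on all configurations because it is a real
  orthogonal coin on the states (nontrivial only at [#] and [$] with empty
  stack) followed by a bijection of the configurations. Since the head starts at
  [#] and can leave neither end of the tape, the bijection has to map the
  configurations over [#] onto themselves plus those that leave, and dually at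
  [$]. This is possible because the set of stacks over [{true, false}] satisfies
  T* = 1 + 2 T*, which lets popping at [#] make room and pushing at [$] absorb
  what arrives. *)

(** * The automaton: tape moves and coins *)

Definition bool_of_dir (m : dir) : bool := if m is Move then true else false.
Definition dir_of_bool (b : bool) : dir := if b then Move else Stay.
Lemma bool_of_dirK : cancel bool_of_dir dir_of_bool.
Proof. by case. Qed.
HB.instance Definition _ := Equality.copy dir (can_type bool_of_dirK).

(** A state is (halting flag, sign, copy). In the tape moves below, the stack
  symbol [true] is the unary digit; [false] occurs in no reachable stack before
  [$] and is there only for reversibility. *)
Definition st := (bool * bool * bool)%type.

(** [Some false] increments and [Some true] decrements the counter of copy [j]. *)
Definition counter_dir (j : bool) (l : sigma3) : option bool :=
  if l == la then Some false
  else if l == (if j then lc else lb) then Some true else None.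

(** Nonnegative counter values m are coded by (sign [false], m digits), negative
  values -m-1 by (sign [true], m digits), so that a step across zero only flips
  the sign. *)
Definition rule (a : tsym sigma3) (b : option bool) (p : st) :
    st * dir * seq (option bool) :=
  let: (h, s, j) := p in
  match a with
  | THash =>
      match b with
      | None => (p, Move, [:: None])
      | Some t => if h then ((false, s, j), Move, [:: Some t])
                  else ((~~ t, s, j), Stay, [::])
      end
  | TDollar =>
      match b with
      | None => ((true, s, j), Stay, [:: None; Some h])
      | Some t => ((true, s, h), Stay, [:: Some t; Some j])
      end
  | TSym l =>
      if h then (p, if b is None then Move else Stay, [:: b]) else
      match counter_dir j l with
      | None => (p, Move, [:: b])
      | Some g =>
          if g == s then (p, Move, [:: b; Some true])
          else if b == Some true then (p, Move, [::])
          else ((h, ~~ s, j), Move, [:: b])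
      end
  end.

Definition st_init : st := (false, false, false).
Definition st_init' : st := (false, false, true).
(** One state serves both acceptances: the weight split off at [#], and the copy 1 output of the
    beam splitter at [$]. *)
Definition st_acc : st := (true, false, true).

Definition hash_vec (p : st) : RR :=
  if (p == st_init) || (p == st_init') then Num.sqrt (2 / 7)
  else if p == st_acc then Num.sqrt (3 / 7) else 0.

(** On the span of [st_init] and [st_init'], the reflection built from this vector is the Hadamard
    matrix. *)
Definition dollar_vec (p : st) : RR :=
  if (p == st_init) || (p == st_init') then Num.sqrt (1 / 2) else 0.

(** The Householder reflection exchanging the basis vector [st_init] with the
  unit vector [v] (the identity if they coincide, as 1 / 0 = 0). *)
Definition refl (v : st -> RR) (p q : st) : RR :=
  (p == q)%:R - ((p == st_init)%:R - v p) * ((q == st_init)%:R - v q)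
                / (1 - v st_init).

Definition coin (a : tsym sigma3) (b : option bool) : st -> st -> RR :=
  match a, b with
  | THash, None => refl hash_vec
  | TDollar, None => refl dollar_vec
  | _, _ => fun p q => (p == q)%:R
  end.

(** The coin acts before the rule, and [p] is the intermediate state between the two. *)
Definition A5 : QPA sigma3 :=
  @Build_QPA sigma3 st bool st_init
    [set st_acc] [set p : st | p.1.1 && (p != st_acc)]
    (fun q a b q' m om =>
       \sum_(p : st) if rule a b p == (q', m, om) then (coin a b p q)%:C%C
                     else 0).

(** * Orthogonality of the coins *)

Lemma sqrt_sqr (r : RR) : 0 <= r -> Num.sqrt r * Num.sqrt r = r.
Proof. by move=> ?; rewrite -expr2 sqr_sqrtr. Qed.

Lemma hash_vec_unit : \sum_p hash_vec p * hash_vec p = 1.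
Proof.
rewrite (bigD1 st_init) //= (bigD1 st_init') //= (bigD1 st_acc) //= big1.
  rewrite /hash_vec /= !sqrt_sqr; lra.
by rewrite /hash_vec => p /andP[/andP[/negbTE-> /negbTE->] /negbTE->]; rewrite mul0r.
Qed.

Lemma dollar_vec_unit : \sum_p dollar_vec p * dollar_vec p = 1.
Proof.
rewrite (bigD1 st_init) //= (bigD1 st_init') //= big1.
  rewrite /dollar_vec /= !sqrt_sqr; lra.
by rewrite /dollar_vec => p /andP[/negbTE-> /negbTE->]; rewrite mul0r.
Qed.

Lemma refl_sym v p q : refl v p q = refl v q p.
Proof. by rewrite /refl eq_sym [X in _ - X / _]mulrC. Qed.

Lemma sum_delta (f : st -> RR) q : \sum_p (p == q)%:R * f p = f q.
Proof.
rewrite (bigD1 q) //= eqxx mul1r big1 ?addr0 // => p /negbTE->.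
by rewrite mul0r.
Qed.

(** For a unit vector [v] and [n = e - v], with [e] the basis vector at [st_init], the squared norm
    of [n] is [2 * (1 - v st_init)]. Hence the rank-one term of [refl v] has exactly the coefficient
    of a reflection along [n]. *)
Lemma refl_orth v : \sum_p v p * v p = 1 ->
  forall q q', \sum_p refl v p q * refl v p q' = (q == q')%:R.
Proof.
move=> v1 q q'; pose n p := (p == st_init)%:R - v p.
pose k := (1 - v st_init)^-1.
have n2 : \sum_p n p * n p = 2 * (1 - v st_init).
  transitivity (\sum_p ((p == st_init)%:R * (1 - 2 * v p) + v p * v p)).
    by apply: eq_bigr => p _; rewrite /n; case: eqP => _ /=; ring.
  by rewrite big_split sum_delta /= v1; ring.
have kn : k * k * (2 * (1 - v st_init)) = 2 * k.
  (* In the degenerate case [k] is [0] by the convention on inverses, and both sides vanish. *)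
  rewrite /k; have [->|v0] := eqVneq (1 - v st_init) 0.
    by rewrite invr0; ring.
  by field.
transitivity (\sum_p ((p == q)%:R * ((p == q')%:R - k * n p * n q')
   + ((p == q')%:R * (- k * n p * n q) + k * k * n q * n q' * (n p * n p)))).
  by apply: eq_bigr => p _; rewrite /refl -/(n p) -/(n q) -/(n q') -/k; ring.
rewrite !big_split /= !sum_delta -mulr_sumr n2.
transitivity ((q == q')%:R - 2 * k * n q * n q'
   + n q * n q' * (k * k * (2 * (1 - v st_init)))); first by ring.
by rewrite kn; ring.
Qed.

Lemma coin_orth a b q q' :
  \sum_p coin a b p q * coin a b p q' = (q == q')%:R.
Proof.
have id_orth : \sum_p (p == q)%:R * (p == q')%:R = (q == q')%:R :> RR.
  exact: sum_delta.
case: a => [l||]; case: b => [t|] //=; apply: refl_orth.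
  exact: hash_vec_unit.
exact: dollar_vec_unit.
Qed.

Lemma coin_sym a b p q : coin a b p q = coin a b q p.
Proof.
by case: a => [l||]; case: b => [t|] /=; rewrite 1?refl_sym // eq_sym.
Qed.

(** * Amplitudes as a coin followed by routing *)

Notation top5 w := (@top sigma3 A5 w).
Notation next5 := (@next_cfg sigma3 A5).
Notation amp5 := (@amp sigma3 A5).

Definition route (x : seq sigma3) (c : config A5) : config A5 :=
  let: (p, i, w) := c in
  let: (q', m, om) := rule (tape_sym x i) (top5 w) p in
  next5 c q' m om.

Lemma words2_uniq (A : QPA sigma3) : uniq (words2 A).
Proof.
rewrite /words2 !cat_uniq; apply/and3P; split=> //.
  rewrite has_sym /= orbF mem_cat negb_or; apply/andP; split; first by apply/mapP => -[].
  by apply/allpairsP => -[? []].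
rewrite map_inj_uniq ?enum_uniq => [/=|? ? []//].
rewrite allpairs_uniq ?enum_uniq // => [|[? ?] [? ?] _ _ [-> ->]//].
rewrite andbT; apply/hasPn => _ /allpairsP[[a b] /= [_ _ ->]].
by apply/mapP => -[].
Qed.

Lemma mem_words2 (A : QPA sigma3) (om : seq (option (qstack A))) :
  (om \in words2 A) = (size om <= 2)%N.
Proof.
rewrite /words2 !mem_cat inE; case: om => [|a [|b [|e om]]] //=.
- by rewrite map_f // mem_enum.
- rewrite orbC; apply/orP; left.
  by apply/allpairsP; exists (a, b); rewrite !mem_enum.
- apply/negbTE; rewrite negb_or; apply/andP; split; first by apply/mapP => -[].
  by apply/allpairsP => -[? []].
Qed.

Lemma size_rule a b p : (size (rule a b p).2 <= 2)%N.
Proof.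
case: p => [[h s] j]; case: a => [l||]; case: b => [t|] //=; case: h => //=;
  by case: counter_dir => [g|] //=; case: eqP => //=; case: eqP.
Qed.

Lemma big_pred1_seq (I : eqType) (s : seq I) (i0 : I) (P : pred I) (F : I -> CC) :
  uniq s -> i0 \in s ->
  \sum_(i <- s) (if (i0 == i) && P i then F i else 0) =
  (if P i0 then F i0 else 0).
Proof.
move=> us i0s; rewrite (bigD1_seq i0) //= eqxx big1 ?addr0 // => i.
by rewrite eq_sym => /negbTE->.
Qed.

(** [rule] is deterministic, so for each [p] a single triple of state, direction and word can
    contribute. Its word has length at most two and [words2] is free of duplicates, so the triple is
    counted exactly once. *)
Lemma ampE x d (q : st) i w :
  amp5 x d (q, i, w) =
  \sum_(p : st) if route x (p, i, w) == d
    then (coin (tape_sym x i) (top5 w) p q)%:C%C else 0.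
Proof.
rewrite /amp.
(* The test on the triple is split into one test per index, so that the inner sums collapse in
   turn. *)
transitivity (\sum_(p : st) \sum_(q' : st) \sum_(m <- [:: Stay; Move])
  \sum_(om <- words2 A5)
    if ((rule (tape_sym x i) (top5 w) p).1.1 == q')
       && ((rule (tape_sym x i) (top5 w) p).1.2 == m)
       && ((rule (tape_sym x i) (top5 w) p).2 == om)
       && (next5 (q, i, w) q' m om == d)
    then (coin (tape_sym x i) (top5 w) p q)%:C%C else 0 : CC).
  rewrite [RHS]exchange_big; apply: eq_bigr => q' _ /=.
  rewrite [RHS]exchange_big; apply: eq_bigr => m _ /=.
  rewrite [RHS]exchange_big; apply: eq_bigr => om _ /=.
  case: ifP => [|] _; last by rewrite big1 // => p _; rewrite andbF.
  by apply: eq_bigr => p _; rewrite andbT; case: rule => -[].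
apply: eq_bigr => p _.
rewrite /route; case E: (rule _ _ p) => [[q' m] om] /=.
rewrite (bigD1 q') //= [X in _ + X]big1 ?addr0; last first.
  move=> q'' /negbTE nq; apply: big1 => m' _; apply: big1 => om' _.
  by rewrite eq_sym nq.
rewrite (bigD1_seq m) /=; last 2 first.
- by case: (m); rewrite !inE.
- by [].
rewrite [X in _ + X]big1 ?addr0; last first.
  move=> m' /negbTE nm; apply: big1 => om' _.
  by rewrite (eq_sym m) nm andbF.
rewrite !eqxx /= (big_pred1_seq _ _ om) //; first exact: (words2_uniq A5).
rewrite (mem_words2 A5).
by have := size_rule (tape_sym x i) (top5 w) p; rewrite E.
Qed.

(** * Reversibility of the routing *)

Definition pop (w : seq bool) : seq bool := take (size w).-1 w.

(** Each configuration reveals the rule that produced it. Off [#], a set flag with a nonempty stack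
    marks a stay; everything else came from the square to the left. At [$], a one-symbol stack was
    empty before and its symbol is the old flag; on a taller stack the top is the old copy bit and
    the state holds the old flag. *)
Definition unroute (x : seq sigma3) (d : config A5) : config A5 :=
  let: (p, i, w) := d in
  let: (h, s, j) := p in
  if i is k.+1 then
    if h && (w != [::]) then
      if tape_sym x i is TDollar then
        if pop w == [::] then (last h w, s, j, i, pop w)
        else (j, s, last h w, i, pop w)
      else d
    else match tape_sym x k with
      | THash => if w == [::] then (p, k, w) else (true, s, j, k, w)
      | TSym l =>
          if h then (p, k, w) else
          match counter_dir j l with
          | None => (p, k, w)
          | Some g =>
              if s == g then
                if top5 w == Some true then (p, k, pop w)
                else (h, ~~ s, j, k, w)
              else (p, k, rcons w true)
          end
      | TDollar => d
      end
  else (false, s, j, i, rcons w (~~ h)).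

Lemma top_rcons (w : seq bool) t : top5 (rcons w t) = Some t.
Proof. by rewrite /top rev_rcons. Qed.

Lemma pop_rcons w t : pop (rcons w t) = w.
Proof. by rewrite /pop size_rcons -cats1 take_size_cat. Qed.

Lemma rcons_nil (w : seq bool) t : (rcons w t == [::]) = false.
Proof. by rewrite -size_eq0 size_rcons. Qed.

Lemma route_nil x (p : st) i :
  route x (p, i, [::]) =
  let: (q', m, om) := rule (tape_sym x i) None p in
  (q', if m is Move then i.+1 else i, pmap id (behead om)).
Proof. by []. Qed.

Lemma route_rcons x (p : st) i (w : seq bool) (t : bool) :
  route x (p, i, rcons w t) =
  let: (q', m, om) := rule (tape_sym x i) (Some t) p in
  (q', if m is Move then i.+1 else i, w ++ pmap id om).
Proof.
rewrite /route /= top_rcons; case: rule => -[q' m] om.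
rewrite /next_cfg /cstk /=.
case E: (rcons w t) => [|b u]; first by case: (w) E.
by rewrite -E -/(pop (rcons w t)) pop_rcons.
Qed.

Arguments route : simpl never.

Lemma tape_symS (x : seq sigma3) i : tape_sym x i.+1 <> THash.
Proof. by rewrite /tape_sym /=; case: onth. Qed.

Lemma tape_symP (x : seq sigma3) i :
  (i <= size x)%N -> tape_sym x i <> TDollar.
Proof.
by case: i => [//|i]; rewrite /tape_sym /= -onthTE; case: onth.
Qed.

Lemma tape_sym_end (x : seq sigma3) : tape_sym x (size x).+1 = TDollar.
Proof. by rewrite /tape_sym /= onth_default. Qed.

(** At [$] every rule stays, so the head cannot pass the last square. *)
Lemma route_valid x (c : config A5) : valid x c -> valid x (route x c).
Proof.
case: c => [[p i] w]; rewrite /valid /cpos /= !addn2 !ltnS => vi.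
rewrite /route; have [ile|igt] := leqP i (size x).
  by case: rule => -[q' []] om.
have -> : i = (size x).+1 by apply/eqP; rewrite eqn_leq vi.
rewrite tape_sym_end; case: p => -[h s] j.
by case: top.
Qed.

Lemma routeK_aux x (h s j : bool) i (w : seq bool) : (i <= (size x).+1)%N ->
  unroute x (route x (h, s, j, i, w)) = (h, s, j, i, w).
Proof.
move=> vi.
case: i vi => [|i] vi.
  case: (lastP w) => [|{}w t]; first by rewrite route_nil /= andbF.
  rewrite route_rcons; case: h => /=; rewrite ?cats1 ?cats0 ?negbK //.
  by rewrite rcons_nil.
case: (leqP i.+1 (size x)) => [ile|]; last first.
  move=> ilt; have -> : i = size x by move: vi ilt; lia.
  case: (lastP w) => [|{}w t].
    by rewrite route_nil tape_sym_end /= tape_sym_end.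
  rewrite route_rcons tape_sym_end /= tape_sym_end.
  rewrite -cat1s catA !cats1 rcons_nil pop_rcons rcons_nil.
  by rewrite !last_rcons.
case a: (tape_sym x i.+1) => [l||]; [|by case: (tape_symS x i)|by case: (tape_symP x _ ile)].
case: (lastP w) => [|{}w t]; rewrite (route_nil, route_rcons) a /=.
  case: h => /=; rewrite ?a //.
  case E: (counter_dir j l) => [g|] /=; last by rewrite a E.
  case: eqP => [gs|/eqP gs] /=; rewrite a E.
    by rewrite gs eqxx.
  by case: (s) (g) gs => [] [] //= _; rewrite eqxx.
case: h => /=; first by rewrite cats1 rcons_nil a.
case E: (counter_dir j l) => [g|] /=; last by rewrite a E cats1.
case: eqP => [gs|/eqP gs] /=.
  by rewrite a E gs eqxx -cat1s catA !cats1 top_rcons pop_rcons.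
(* A top [true] was removed and is pushed back by [unroute]; over a top [false] the sign was flipped
   to [g] and is flipped back. *)
case: t => /=; rewrite a E.
  by rewrite cats0 eq_sym (negbTE gs).
by rewrite cats1 top_rcons /=; case: (s) (g) gs => [] [].
Qed.

Lemma routeK x (c : config A5) : valid x c -> unroute x (route x c) = c.
Proof.
case: c => [[[[h s] j] i] w]; rewrite /valid /cpos /= addn2 ltnS => vi.
exact: routeK_aux.
Qed.

Lemma unrouteK_aux x (h s j : bool) i (w : seq bool) : (i <= (size x).+1)%N ->
  route x (unroute x (h, s, j, i, w)) = (h, s, j, i, w).
Proof.
case: i => [|i] vi.
  by rewrite /= route_rcons /= negbK cats0.
rewrite /=; have [/andP[-> w0]|hw] := boolP (h && (w != [::])).
  case: (leqP i.+1 (size x)) => [ile|ilt].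
    case a: (tape_sym x i.+1) => [l||]; [|by case: (tape_symS x i)|by case: (tape_symP x _ ile)].
    case: (lastP w) w0 => // {}w t _.
    by rewrite route_rcons a /= cats1.
  have -> : i = size x by move: vi ilt; lia.
  rewrite tape_sym_end.
  case: (lastP w) w0 => // {}w t _; rewrite pop_rcons last_rcons.
  case: (lastP w) => [|{}w t'].
    by rewrite eqxx route_nil tape_sym_end.
  rewrite rcons_nil route_rcons tape_sym_end /=.
  by rewrite -cat1s catA !cats1.
(* The stays are done; what remains arrived from the left. *)
case a: (tape_sym x i) => [l||]; last by case: (tape_symP x _ _ a).
  case: h hw => /= [|_].
    by rewrite negbK => /eqP->; rewrite route_nil a.
  case E: (counter_dir j l) => [g|]; last first.
    by case: (lastP w) => [|{}w t]; rewrite (route_nil, route_rcons) a /= E //= cats1.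
  case: eqP => [->|sg].
    case: (lastP w) => [|{}w t].
      by rewrite route_nil a /= E /=; case: (g).
    rewrite top_rcons pop_rcons; case: t => /=.
      case: (lastP w) => [|{}w t]; rewrite (route_nil, route_rcons) a /= E /= eqxx //=.
      by rewrite -!cats1 -catA.
    by rewrite route_rcons a /= E /=; case: (g); rewrite /= cats1.
  rewrite route_rcons a /= E /=; case: eqP => [gs|_]; first by case: sg.
  by rewrite /= cats0.
case: eqP hw => [-> _|/eqP w0]; first by rewrite route_nil a.
rewrite andbT => /negbTE->.
by case: (lastP w) w0 => // {}w t _; rewrite route_rcons a /= cats1.
Qed.

Lemma unrouteK x (d : config A5) : valid x d -> route x (unroute x d) = d.
Proof.
case: d => [[[[h s] j] i] w]; rewrite /valid /cpos /= addn2 ltnS => vi.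
exact: unrouteK_aux.
Qed.

Lemma unroute_valid x (d : config A5) : valid x d -> valid x (unroute x d).
Proof.
case: d => [[[[h s] j] i] w]; rewrite /valid /cpos /= addn2 ltnS => vi.
case: i vi => [//|i] vi.
case: ifP => _; first by case: tape_sym => // *; case: ifP.
have vi' : (i <= (size x).+1)%N by exact: leq_trans vi.
case: tape_sym => [l||] //; first by case: h => //=;
  case: counter_dir => [g|] //; case: eqP => //; case: eqP.
by case: eqP.
Qed.

(** * Unitarity *)

Definition coin_cfg (x : seq sigma3) (e c : config A5) : RR :=
  if (cpos e == cpos c) && (cstk e == cstk c)
  then coin (tape_sym x (cpos c)) (top (cstk c)) (Defs.cst e) (Defs.cst c) else 0.

Lemma coin_cfg_sym x e c : coin_cfg x e c = coin_cfg x c e.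
Proof.
rewrite /coin_cfg eq_sym [X in _ && X]eq_sym; case: andP => // -[/eqP-> /eqP->].
by rewrite coin_sym.
Qed.

(** On valid configurations [route] is a permutation with inverse [unroute], so the row of [d] is
    the row of the coin at [unroute x d]. *)
Lemma ampE_valid x (d c : config A5) : valid x d -> valid x c ->
  amp5 x d c = (coin_cfg x (unroute x d) c)%:C%C.
Proof.
case: c => [[q i] w] vd vc; rewrite ampE.
have eqd (p : st) : (route x (p, i, w) == d) = (unroute x d == (p, i, w)).
  by apply/eqP/eqP => [<-|<-]; rewrite (routeK, unrouteK).
under eq_bigr => p _ do rewrite eqd.
case: (unroute x d) => [[p0 i0] w0]; rewrite /coin_cfg /cpos /cstk /=.
case: eqP => [->|ni]; last by rewrite big1 // => p _; case: eqP => // -[].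
case: eqP => [->|nw]; last by rewrite big1 // => p _; case: eqP => // -[].
rewrite (bigD1 p0) //= eqxx big1 ?addr0 // => p np.
by case: eqP => // -[pp]; rewrite pp eqxx in np.
Qed.

(** Trades an arbitrary list covering the support for a convenient one: a block of the coin, and
    later the support list of a step. *)
Lemma big_uniq_supp (R : nmodType) (I : eqType) (s1 s2 : seq I) (F : I -> R) :
  uniq s1 -> uniq s2 -> (forall i, F i != 0 -> (i \in s1) && (i \in s2)) ->
  \sum_(i <- s1) F i = \sum_(i <- s2) F i.
Proof.
have F0 (s : seq I) : \sum_(i <- s) F i = \sum_(i <- [seq i <- s | F i != 0]) F i.
  rewrite big_filter [LHS](bigID (fun i => F i != 0)) /= [X in _ + X]big1 ?addr0 //.
  by move=> i /negPn/eqP.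
move=> u1 u2 supp; rewrite (F0 s1) (F0 s2); apply/perm_big/uniq_perm.
- exact: filter_uniq.
- exact: filter_uniq.
by move=> i; rewrite !mem_filter; case: eqP => //= /eqP/supp/andP[-> ->].
Qed.

(** The coin is block diagonal, with one block of eight states per position and stack. Within a
    block this is [coin_orth]; columns from different blocks have disjoint supports. *)
Lemma coin_cfg_orth x (e e' : config A5) (s : seq (config A5)) : uniq s ->
  (forall c, (coin_cfg x c e != 0) || (coin_cfg x c e' != 0) -> c \in s) ->
  \sum_(c <- s) coin_cfg x c e * coin_cfg x c e' = (e == e')%:R.
Proof.
case: e e' => [[q i] w] [[q' i'] w'] us supp.
pose blk := [seq ((p, i, w) : config A5) | p <- enum {: st}].
have ublk : uniq blk by rewrite map_inj_uniq ?enum_uniq // => p p' [].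
rewrite (@big_uniq_supp _ _ _ blk) //; last first.
  move=> [[p j] u]; rewrite mulf_eq0 negb_or => /andP[n0 _].
  rewrite supp ?n0 //=; apply/mapP; exists p; first by rewrite mem_enum.
  by move: n0; rewrite /coin_cfg /cpos /cstk /=; case: andP => [[/eqP-> /eqP->]|_]; rewrite ?eqxx.
rewrite big_map big_enum /= /coin_cfg /cpos /cstk /Defs.cst /= !eqxx /=.
have [[-> ->]|ne] := @eqP _ (i, w) (i', w').
  rewrite !eqxx coin_orth; congr (_ %:R); congr nat_of_bool.
  by apply/eqP/eqP => [->|[]].
rewrite big1 => [|p _].
  by case: eqP => // -[_ ei ew]; case: ne; rewrite ei ew.
case: andP => [[/eqP ei /eqP ew]|_]; last by rewrite mulr0.
by case: ne; rewrite ei ew.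
Qed.

Lemma coin_cfg_valid x e c : coin_cfg x e c != 0 -> valid x e = valid x c.
Proof. by rewrite /coin_cfg /valid; case: andP => [[/eqP-> _]|]; rewrite ?eqxx. Qed.

Lemma conj_real (r : RR) : ((r%:C%C : CC)^*)%R = r%:C%C.
Proof. exact: conjc_real. Qed.

(** Reindexing along [unroute] turns columns into columns of the coin. Rows become rows of the coin,
    which are columns by symmetry. *)
Lemma A5_unitary : unitary_U A5.
Proof.
move=> x; split=> [c c' vc vc' s us supp|d d' vd vd' s us supp].
  transitivity ((\sum_(e <- [seq unroute x d | d <- s & valid x d])
                  coin_cfg x e c * coin_cfg x e c')%:C%C : CC).
    rewrite big_map big_filter rmorph_sum /=; apply: eq_bigr => d vd.
    by rewrite !ampE_valid // conj_real rmorphM.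
  rewrite coin_cfg_orth ?rmorph_nat //.
    rewrite map_inj_in_uniq ?filter_uniq // => d d'.
    rewrite !mem_filter => /andP[vd _] /andP[vd' _] /(congr1 (route x)).
    by rewrite !unrouteK.
  move=> e n0; have ve : valid x e.
    by case/orP: n0 => /coin_cfg_valid->.
  apply/mapP; exists (route x e); last by rewrite routeK.
  rewrite mem_filter route_valid //= supp ?route_valid //.
  by rewrite !ampE_valid ?route_valid // routeK // !fmorph_eq0.
transitivity ((\sum_(c <- [seq c <- s | valid x c])
                coin_cfg x c (unroute x d) * coin_cfg x c (unroute x d'))%:C%C : CC).
  rewrite big_filter rmorph_sum /=; apply: eq_bigr => c vc.
  by rewrite !ampE_valid // conj_real !(coin_cfg_sym x c) rmorphM.
rewrite coin_cfg_orth ?filter_uniq //.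
  rewrite rmorph_nat; congr (_ %:R); congr nat_of_bool.
  by apply/eqP/eqP => [|->//] /(congr1 (route x)); rewrite !unrouteK.
move=> c n0; have vc : valid x c.
  by case/orP: n0 => /coin_cfg_valid->; exact: unroute_valid.
rewrite mem_filter vc supp // !ampE_valid // !fmorph_eq0.
by rewrite !(coin_cfg_sym x _ c).
Qed.

(** * Form of the transition function *)

Lemma delta_neq0 (q : st) a (b : option bool) (q' : st) m (om : seq (option bool)) :
  @delta sigma3 A5 q a b q' m om != 0 -> exists p, rule a b p = (q', m, om).
Proof.
have [/existsP[p /eqP]|/existsPn nex] :=
  boolP [exists p : st, rule a b p == (q', m, om)]; first by exists p.
by rewrite /delta /= big1 ?eqxx // => p _; rewrite (negbTE (nex p)).
Qed.

(** The coin mixes only states, so every written word comes from a rule: it keeps the top, adds one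
    symbol above it, or pops a symbol other than the base. *)
Lemma A5_wf : delta_wf A5.
Proof.
move=> q a b q' m om /delta_neq0[p E].
have shape : [\/ om = [:: b], exists t, om = [:: b; Some t] | om = [::] /\ b <> None].
  case: p a b E => [[h s] j] [l||] [t|] /=; try (case=> _ _ <-; by constructor 1).
  - case: h => [[_ _ <-]|]; first by constructor 1.
    case: counter_dir => [g|[_ _ <-]]; last by constructor 1.
    case: ifP => _; first by case=> _ _ <-; constructor 2; exists true.
    by case: ifP => _ [_ _ <-]; [constructor 3|constructor 1].
  - case: h => [[_ _ <-]|]; first by constructor 1.
    case: counter_dir => [g|[_ _ <-]]; last by constructor 1.
    by case: ifP => _ [_ _ <-]; [constructor 2; exists true|constructor 1].
  - by case: h => -[_ _ <-]; [constructor 1|constructor 3].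
  - by case=> _ _ <-; constructor 2; exists j.
  - by case=> _ _ <-; constructor 2; exists h.
case: shape => [->|[t ->]|[-> bN]]; split=> //.
- by move=> ->; exists [::].
- by move=> t ->; exists [:: t].
- by move=> ->; exists [:: t].
- by move=> u ->; exists [:: u; t].
- by exists [::].
Qed.

Lemma A5_QPA : is_QPA A5.
Proof.
split; last split; last split; [|exact: A5_wf| |exact: A5_unitary].
  rewrite -setI_eq0; apply/eqP/setP => p; rewrite !inE.
  by case: (p == st_acc); rewrite ?andbF.
move=> q b q' om; apply/eqP; apply: contraT => /delta_neq0[[[h s] j]].
by case: b.
Qed.

(** * Supports and halting probabilities *)

Lemma amp_succs (x : seq sigma3) (d c : config A5) : amp5 x d c != 0 -> d \in succs c.
Proof.
apply: contraNT => dn; rewrite /amp big1 // => q' _.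
rewrite big_seq big1 // => m mM; rewrite big_seq big1 // => om omW.
case: eqP => // dE; case/negP: dn; rewrite /succs; apply/allpairsP; exists (q', (m, om)).
rewrite /= mem_enum; split => //; exact: (allpairs_f (fun m om => (m, om))) mM omW.
Qed.

Lemma mem_step_supp (x : seq sigma3) (s : seq (config A5)) d c :
  c \in s -> amp5 x d c != 0 -> d \in step_supp s.
Proof.
move=> cs /amp_succs dc; rewrite mem_undup; apply/flattenP.
by exists (succs c) => //; exact: map_f.
Qed.

Lemma Uapp_supp (x : seq sigma3) (s : seq (config A5)) phi d :
  Uapp x s phi d != 0 -> d \in step_supp s.
Proof.
apply: contraNT => dn; rewrite /Uapp big_seq big1 // => c cs.
have [->|n0] := eqVneq (amp5 x d c) 0; first by rewrite mul0r.
by case/negP: dn; exact: mem_step_supp n0.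
Qed.

Lemma evol_uniq (x : seq sigma3) n : uniq (evol A5 x n).1.
Proof. by case: n => [//|n] /=; case: (evol A5 x n) => s phi; exact: undup_uniq. Qed.

Lemma sqn_ge0 z : 0 <= sqn z.
Proof. by rewrite /sqn addr_ge0 // sqr_ge0. Qed.

Lemma sqn_real (r : RR) : sqn r%:C%C = r ^+ 2.
Proof. by rewrite /sqn /= [0 ^+ 2]expr0n addr0. Qed.

(** Amplitudes vanish outside [step_supp s], so any duplicate-free list of configurations in [P]
    gives a lower bound, without locating its members in the support. *)
Lemma sum_sqn_le (x : seq sigma3) (s : seq (config A5)) phi (P : pred (config A5)) ds :
  uniq ds -> all P ds ->
  \sum_(d <- ds) sqn (Uapp x s phi d) <=
  \sum_(d <- step_supp s | P d) sqn (Uapp x s phi d).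
Proof.
move=> uds /allP Pds; set F := fun d => sqn (Uapp x s phi d).
pose F' d := if d \in ds then F d else 0.
rewrite [leRHS]big_mkcond; apply: (@le_trans _ _ (\sum_(d <- step_supp s) F' d)).
  have -> : \sum_(d <- ds) sqn (Uapp x s phi d) = \sum_(d <- ds) F' d.
    by apply: eq_big_seq => d dds; rewrite /F' dds.
  rewrite (@big_uniq_supp _ _ ds (step_supp s)) ?undup_uniq // => d.
  rewrite /F'; case: ifP => [_ Fn0|]; last by rewrite eqxx.
  apply: (@Uapp_supp x _ phi); apply: contraNneq Fn0 => Un0.
  by rewrite /F Un0 /sqn /= expr0n addr0.
apply: ler_sum => d _; rewrite /F'; case: ifP => [/Pds->//|_].
by case: ifP => // _; exact: sqn_ge0.
Qed.

Lemma p_acc_step_ge x n ds : uniq ds -> all (fun d : config A5 => Defs.cst d \in Q_acc A5) ds ->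
  \sum_(d <- ds) sqn (Uapp x (evol A5 x n).1 (evol A5 x n).2 d) <= p_acc_step A5 x n.
Proof. by move=> u a; rewrite /p_acc_step; case: evol => s phi; exact: sum_sqn_le. Qed.

Lemma p_rej_step_ge x n ds : uniq ds -> all (fun d : config A5 => Defs.cst d \in Q_rej A5) ds ->
  \sum_(d <- ds) sqn (Uapp x (evol A5 x n).1 (evol A5 x n).2 d) <= p_rej_step A5 x n.
Proof. by move=> u a; rewrite /p_rej_step; case: evol => s phi; exact: sum_sqn_le. Qed.

Lemma p_acc_step_ge0 x n : 0 <= p_acc_step A5 x n.
Proof. by have := @p_acc_step_ge x n [::]; rewrite big_nil; exact. Qed.

Lemma p_rej_step_ge0 x n : 0 <= p_rej_step A5 x n.
Proof. by have := @p_rej_step_ge x n [::]; rewrite big_nil; exact. Qed.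

Lemma partial_sum_le (u : nat -> RR) n : (forall k, 0 <= u k) ->
  ((\sum_(0 <= k < n) u k)%:E <= \sum_(0 <= k <oo) (u k)%:E)%E.
Proof.
move=> u0; rewrite -sumEFin.
by apply: nneseries_lim_ge => k _ _; rewrite lee_fin.
Qed.

(** * The run of the two copies on the letters *)

Definition two_state (x : seq sigma3) n (a : RR) (c1 c2 : config A5) : Prop :=
  [/\ c1 \in (evol A5 x n).1, c2 \in (evol A5 x n).1 &
    forall c, (evol A5 x n).2 c = a%:C%C * ((c == c1)%:R + (c == c2)%:R)].

Lemma Uapp_two_state x n a c1 c2 d : two_state x n a c1 c2 ->
  Uapp x (evol A5 x n).1 (evol A5 x n).2 d = a%:C%C * (amp5 x d c1 + amp5 x d c2).
Proof.
move=> [c1s c2s phiE]; rewrite /Uapp.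
have point c0 : c0 \in (evol A5 x n).1 ->
    \sum_(c <- (evol A5 x n).1) amp5 x d c * (c == c0)%:R = amp5 x d c0.
  move=> c0s; rewrite (bigD1_seq c0) ?evol_uniq //= eqxx mulr1 big1 ?addr0 //.
  by move=> c /negbTE->; rewrite mulr0.
rewrite -(point c1) // -(point c2) // -big_split mulr_sumr.
by apply: eq_bigr => c _; rewrite phiE /=; ring.
Qed.

Lemma amp_route x (d : config A5) (q : st) i (w : seq bool) :
  (forall p, coin (tape_sym x i) (top5 w) p q = (p == q)%:R) ->
  amp5 x d (q, i, w) = (d == route x (q, i, w))%:R.
Proof.
move=> cid; rewrite ampE (bigD1 q) //= cid eqxx big1 ?addr0.
  by rewrite eq_sym; case: eqP.
by move=> p /negbTE pq; rewrite cid pq; case: ifP.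
Qed.

(** Where the coin is trivial each branch is merely routed, and both targets survive the
    measurement. *)
Lemma two_stateS x n a (q1 q2 : st) i1 i2 (w1 w2 : seq bool) :
  let c1 := ((q1, i1, w1) : config A5) in
  let c2 := ((q2, i2, w2) : config A5) in
  (forall p, coin (tape_sym x i1) (top5 w1) p q1 = (p == q1)%:R) ->
  (forall p, coin (tape_sym x i2) (top5 w2) p q2 = (p == q2)%:R) ->
  nonhalting (Defs.cst (route x c1)) -> nonhalting (Defs.cst (route x c2)) ->
  two_state x n a c1 c2 -> two_state x n.+1 a (route x c1) (route x c2).
Proof.
move=> c1 c2 cid1 cid2 nh1 nh2 ts.
have UE := fun d => Uapp_two_state _ _ _ _ _ d ts.
case: ts => c1s c2s _; rewrite /two_state /=.
case: (evol A5 x n) UE c1s c2s => s phi /= UE c1s c2s.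
split.
- by apply: (mem_step_supp x _ _ c1) => //; rewrite amp_route // eqxx oner_neq0.
- by apply: (mem_step_supp x _ _ c2) => //; rewrite amp_route // eqxx oner_neq0.
move=> d; rewrite UE !amp_route //; case: ifP => // nh.
(* A halting [d] differs from both targets, so the formula also gives [0] there. *)
case: eqP => [dE|_]; first by rewrite dE nh1 in nh.
case: eqP => [dE|_]; first by rewrite dE nh2 in nh.
by rewrite addr0 mulr0.
Qed.

Definition count_letter (o : option bool) (sm : bool * nat) : bool * nat :=
  let: (s, m) := sm in
  if o is Some g then
    if g == s then (s, m.+1) else if m is m'.+1 then (s, m') else (~~ s, 0%N)
  else (s, m).

Definition counter (j : bool) (y : seq sigma3) : bool * nat :=
  foldl (fun sm l => count_letter (counter_dir j l) sm) (false, 0%N) y.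

Lemma nseq_rcons (T : Type) n (t : T) : rcons (nseq n t) t = nseq n.+1 t.
Proof. by elim: n => //= n ->. Qed.

Definition counter_cfg (j : bool) (k : nat) (sm : bool * nat) : config A5 :=
  ((false, sm.1, j), k, nseq sm.2 true).

(** The code stands for a difference of two counts; the equations are additive to avoid truncated
    subtraction. *)
Lemma counterP j y :
  let: (s, m) := counter j y in
  if s then (count_mem la y + m.+1 = count_mem (if j then lc else lb) y)%N
  else (count_mem la y = count_mem (if j then lc else lb) y + m)%N.
Proof.
elim/last_ind: y => [//|y l]; rewrite /counter foldl_rcons -/(counter j y).
rewrite -cats1 !count_cat /= !addn0; case: (counter j y) => s m.
rewrite /counter_dir.
have lab : la != (if j then lc else lb) by case: j.
have [->|nla] := eqVneq l la.
  by rewrite (negbTE lab); case: s => /=; case: m => [|m] /=; lia.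
by case: (l == _); case: s => /=; case: m => [|m] /=; lia.
Qed.

(** Zero has a single code, since the sign [true] stands for strictly negative values. *)
Lemma counter_eq0 j y : (counter j y == (false, 0%N)) =
  (count_mem la y == count_mem (if j then lc else lb) y).
Proof.
have := counterP j y; case: (counter j y) => -[] m /= E; rewrite xpair_eqE /=; lia.
Qed.

Lemma route_counter_cfg x j k l sm : tape_sym x k = TSym l ->
  route x (counter_cfg j k sm) =
  counter_cfg j k.+1 (count_letter (counter_dir j l) sm).
Proof.
case: sm => s m tk; rewrite /counter_cfg /=.
case: m => [|m]; last rewrite -[nseq m.+1 true]nseq_rcons.
  rewrite route_nil tk /=; case: counter_dir => [g|] //.
  by case: eqP.
rewrite route_rcons tk /=; case: counter_dir => [g|] /=; last first.
  by rewrite cats1 nseq_rcons.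
case: eqP => _ /=; last by rewrite cats0.
by rewrite -cat1s catA !cats1 !nseq_rcons.
Qed.

Lemma sqrt_neq1 (r : RR) : 0 <= r < 1 -> 1 - Num.sqrt r != 0.
Proof.
move=> /andP[r0 r1]; rewrite subr_eq0 eq_sym; apply: contraTneq r1 => s1.
by rewrite -(sqr_sqrtr r0) s1 expr1n ltxx.
Qed.

Lemma refl_init v p : 1 - v st_init != 0 -> refl v p st_init = v p.
Proof. by move=> v1; rewrite /refl eqxx /= mulfK // opprB addrC subrK. Qed.

(** The coin sends [st_init] to [hash_vec]; the projection then removes the [st_acc] component and
    leaves the two copies. *)
Lemma two_state1 x : two_state x 1 (Num.sqrt (2 / 7))
  (counter_cfg false 1 (false, 0%N)) (counter_cfg true 1 (false, 0%N)).
Proof.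
have ampE0 d : amp5 x d (init_cfg A5) =
    if d.2 == [::] then if cpos d == 1%N then (hash_vec (Defs.cst d))%:C%C else 0 else 0.
  rewrite /init_cfg ampE; case: d => [[p i] w]; rewrite /cpos /Defs.cst /=.
  have rE (p' : st) : (route x (p', 0%N, [::]) == (p, i, w)) =
      [&& w == [::], i == 1%N & p' == p].
    rewrite route_nil /=; case: p' => -[h s] j /=.
    rewrite !xpair_eqE /= andbC [(_ && _) && (1%N == i)]andbC.
    by rewrite (eq_sym 1%N) (eq_sym [::]) -!xpair_eqE.
  under eq_bigr => p' _ do rewrite rE.
  case: eqP => _ /=; last by rewrite big1.
  case: eqP => _ /=; last by rewrite big1.
  rewrite -big_mkcond big_pred1_eq refl_init //.
  by apply: sqrt_neq1; lra.
split.
- apply: (@mem_step_supp x _ _ (init_cfg A5)); first by rewrite inE.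
  rewrite ampE0 /= /hash_vec /= fmorph_eq0 sqrtr_eq0 -ltNge; lra.
- apply: (@mem_step_supp x _ _ (init_cfg A5)); first by rewrite inE.
  rewrite ampE0 /= /hash_vec /= fmorph_eq0 sqrtr_eq0 -ltNge; lra.
move=> [[p i] w] /=.
rewrite /Uapp big_seq1 eqxx mulr1 ampE0 /cpos /Defs.cst /= /counter_cfg /=.
rewrite !xpair_eqE.
case: (w == [::]); last by rewrite !andbF addr0 mulr0 if_same.
case: (i == 1%N); last by rewrite !andbF addr0 mulr0 if_same.
rewrite /nonhalting !inE /hash_vec.
case: p => -[[] []] [] /=; rewrite ?addr0 ?add0r ?mulr0 ?mulr1 //.
Qed.

Lemma tape_sym_nth (x : seq sigma3) k : (k < size x)%N ->
  exists2 l, tape_sym x k.+1 = TSym l & take k.+1 x = rcons (take k x) l.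
Proof.
move=> kx; case: x kx => [//|y x] kx; exists (nth y (y :: x) k).
  have := onthTE (y :: x) k; rewrite kx /tape_sym /=.
  by case E: (onth (y :: x) k) => [l|] // _; rewrite -(onth_nth y l _ _ E).
by rewrite -take_nth.
Qed.

(** The first step is spent on [#], so [k.+1] steps read [k] letters. *)
Lemma two_state_run x k : (k <= size x)%N ->
  two_state x k.+1 (Num.sqrt (2 / 7))
    (counter_cfg false k.+1 (counter false (take k x)))
    (counter_cfg true k.+1 (counter true (take k x))).
Proof.
elim: k => [_|k IH kx]; first by rewrite take0; exact: two_state1.
have [l tl ->] := tape_sym_nth x k kx.
rewrite /counter !foldl_rcons -!/(counter _ _).
rewrite -!(route_counter_cfg x _ k.+1 l) //.
apply: two_stateS; rewrite ?tl //; last exact: IH (ltnW kx).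
  by rewrite -/(counter_cfg _ _ _) (route_counter_cfg _ _ _ l) // /nonhalting !inE.
by rewrite -/(counter_cfg _ _ _) (route_counter_cfg _ _ _ l) // /nonhalting !inE.
Qed.

(** * Interference and halting at [$] *)

Definition end_cfg (x : seq sigma3) (p : st) : config A5 := (p, (size x).+1, [:: false]).

Lemma sqrt12_neq1 : 1 - dollar_vec st_init != 0.
Proof. by apply: sqrt_neq1; lra. Qed.

Lemma refl_dollar_id (p q : st) : q != st_init -> q != st_init' ->
  refl dollar_vec p q = (p == q)%:R.
Proof.
move=> /negbTE q1 /negbTE q2.
by rewrite /refl {2}/dollar_vec q1 q2 /= subr0 mulr0 mul0r subr0.
Qed.

(** A nonzero counter has digits on the stack, where the coin is the identity, or an empty stack
    with sign [true], a state fixed by the reflection. *)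
Lemma coin_dollar_id j sm (p : st) : sm != (false, 0%N) ->
  coin TDollar (top5 (nseq sm.2 true)) p (false, sm.1, j) =
  (p == (false, sm.1, j))%:R.
Proof.
case: sm => s [|m] sm0.
  by apply: refl_dollar_id; case: s j sm0 => [] [].
by rewrite -[nseq _ true]nseq_rcons top_rcons.
Qed.

(** Over an empty stack [$] pushes the old flag [false], whence the stack of [end_cfg]. *)
Lemma amp_end0 x j (s j' : bool) :
  amp5 x (end_cfg x (true, s, j)) (counter_cfg j' (size x).+1 (false, 0%N)) =
  (refl dollar_vec (false, s, j) (false, false, j'))%:C%C.
Proof.
rewrite ampE (bigD1 (false, s, j)) //= route_nil tape_sym_end /= eqxx.
rewrite big1 ?addr0 // => -[[h s'] j''] np.
rewrite route_nil tape_sym_end /=; case: eqP => // -[ss jj hh].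
by rewrite ss jj hh eqxx in np.
Qed.

Lemma amp_end_neq0 x d j sm : sm != (false, 0%N) ->
  amp5 x d (counter_cfg j (size x).+1 sm) =
  (d == route x (counter_cfg j (size x).+1 sm))%:R.
Proof.
by move=> sm0; apply: amp_route => p; rewrite tape_sym_end coin_dollar_id.
Qed.

(** With an empty stack the sign is [true]. Otherwise the old flag [false] replaces the copy bit,
    which avoids [st_acc], and the stack has at least two symbols. Either way the beam splitter
    outputs are missed. *)
Lemma route_end x j sm : sm != (false, 0%N) ->
  let d := route x (counter_cfg j (size x).+1 sm) in
  [/\ (Defs.cst d).1.1, Defs.cst d != st_acc &
      forall p : st, p.1.2 = false -> d != end_cfg x p].
Proof.
case: sm => s [|m] sm0 /=.
  rewrite route_nil tape_sym_end /=; case: s sm0 => // _; split=> //.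
  by case=> [[h []] j'] //= _; rewrite /end_cfg !xpair_eqE /= andbF.
rewrite /counter_cfg -nseq_rcons route_rcons tape_sym_end /=; split=> //.
move=> p _; rewrite /end_cfg xpair_eqE negb_and; apply/orP; right.
by apply/eqP => /(congr1 size); rewrite size_cat /=; lia.
Qed.

(** This is the weight of [hash_vec] at [st_acc], measured after the step on [#]. *)
Lemma p_acc_step0 x : 3 / 7 <= p_acc_step A5 x 0.
Proof.
pose d : config A5 := (st_acc, 1%N, [::]).
have := @p_acc_step_ge x 0 [:: d]; rewrite big_seq1 => /(_ isT).
rewrite /= inE /Defs.cst /= => /(_ isT); apply: le_trans.
rewrite /Uapp big_seq1 eqxx mulr1 /init_cfg ampE (bigD1 st_acc) //=.
rewrite big1 => [|[[h s] j] np]; last first.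
  rewrite route_nil /=; case: eqP => // -[hh ss jj].
  by rewrite hh ss jj eqxx in np.
rewrite addr0 refl_init; last by apply: sqrt_neq1; lra.
by rewrite sqn_real /hash_vec /= sqr_sqrtr; lra.
Qed.

Lemma Uapp_end x d :
  Uapp x (evol A5 x (size x).+1).1 (evol A5 x (size x).+1).2 d =
  (Num.sqrt (2 / 7))%:C%C *
    (amp5 x d (counter_cfg false (size x).+1 (counter false x)) +
     amp5 x d (counter_cfg true (size x).+1 (counter true x))).
Proof.
have := two_state_run x (size x) (leqnn _); rewrite take_size.
exact: Uapp_two_state.
Qed.

Lemma sqrt27 : Num.sqrt (2 / 7 : RR) ^+ 2 = 2 / 7.
Proof. by rewrite sqr_sqrtr; lra. Qed.

Lemma sqrt12 : Num.sqrt (1 / 2 : RR) ^+ 2 = 1 / 2.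
Proof. by rewrite sqr_sqrtr; lra. Qed.

Lemma refl_dollar_init p : refl dollar_vec p st_init = dollar_vec p.
Proof. exact/refl_init/sqrt12_neq1. Qed.

Lemma refl_dollar_init' : refl dollar_vec st_init' st_init' = - Num.sqrt (1 / 2).
Proof.
have := sqrt12_neq1; have := sqrt12; rewrite /refl /dollar_vec /=.
set h := Num.sqrt _ => h2 h1.
(* After multiplication by [1 - h], both sides equal [1 / 2 - h]. *)
apply: (mulIf h1); rewrite mulrBl divfK //.
by rewrite mul1r !sub0r mulrNN -expr2 mulrBr mulr1 mulNr -expr2 h2; lra.
Qed.

(** Only the copy with zero counter reaches [d], with amplitude [sqrt (2 / 7) * sqrt (1 / 2)] up to
    sign. *)
Lemma p_acc_step_end x : L5 x -> 1 / 7 <= p_acc_step A5 x (size x).+1.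
Proof.
rewrite /L5 -(counter_eq0 false) -(counter_eq0 true) => xor.
pose d := end_cfg x st_acc.
have := @p_acc_step_ge x (size x).+1 [:: d]; rewrite big_seq1 => /(_ isT).
rewrite /= inE /Defs.cst /= => /(_ isT); apply: le_trans.
rewrite Uapp_end; move: xor.
have [->|c0] := eqVneq (counter false x) (false, 0%N);
  have [->|c1] := eqVneq (counter true x) (false, 0%N) => // _.
- have [_ _ /(_ st_acc erefl) /negbTE nd] := route_end x true _ c1.
  rewrite amp_end0 (amp_end_neq0 x _ _ _ c1) eq_sym nd addr0 -rmorphM /=.
  rewrite sqn_real (refl_dollar_init st_init') exprMn sqrt27 /dollar_vec /= sqrt12; lra.
- have [_ _ /(_ st_acc erefl) /negbTE nd] := route_end x false _ c0.
  rewrite amp_end0 (amp_end_neq0 x _ _ _ c0) eq_sym nd add0r -rmorphM /=.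
  rewrite sqn_real refl_dollar_init' exprMn sqrt27 sqrrN sqrt12; lra.
Qed.

Lemma p_rej_step_end x : ~~ L5 x -> 4 / 7 <= p_rej_step A5 x (size x).+1.
Proof.
rewrite /L5 -(counter_eq0 false) -(counter_eq0 true) negbK.
have [c0|c0] := eqVneq (counter false x) (false, 0%N);
  have [c1|c1] := eqVneq (counter true x) (false, 0%N) => // _.
  (* Both counters are zero: the amplitudes at the copy 0 output have equal sign and add up to
     [2 * sqrt (2 / 7) * sqrt (1 / 2)]. *)
  pose d := end_cfg x (true, false, false).
  have := @p_rej_step_ge x (size x).+1 [:: d]; rewrite big_seq1 => /(_ isT).
  rewrite /= inE /Defs.cst /= => /(_ isT); apply: le_trans.
  rewrite Uapp_end c0 c1 !amp_end0 -rmorphD -rmorphM sqn_real.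
  rewrite refl_dollar_init refl_sym refl_dollar_init /dollar_vec /=.
  by rewrite -mulr2n exprMn exprMn_n sqrt27 sqrt12; lra.
pose d0 := route x (counter_cfg false (size x).+1 (counter false x)).
pose d1 := route x (counter_cfg true (size x).+1 (counter true x)).
have [h0 r0 _] := route_end x false _ c0.
have [h1 r1 _] := route_end x true _ c1.
(* Routing is injective and the sources differ in the copy bit, so the two weights [2 / 7] add
   without interference. *)
have d01 : d0 != d1.
  apply/eqP => /(congr1 (unroute x)); rewrite !routeK //.
  - by rewrite /valid /cpos /= addn2.
  - by rewrite /valid /cpos /= addn2.
have := @p_rej_step_ge x (size x).+1 [:: d0; d1]; rewrite big_cons big_seq1.
rewrite /= inE d01 !inE h0 h1 r0 r1 => /(_ isT isT); apply: le_trans.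
rewrite !Uapp_end !amp_end_neq0 // -/d0 -/d1 !eqxx (negbTE d01) eq_sym (negbTE d01).
by rewrite addr0 add0r mulr1 sqn_real sqrt27; lra.
Qed.

Theorem theorem5 :
  exists A : QPA sigma3, is_QPA A /\
    (forall x : seq sigma3, L5 x -> ((4 / 7 : RR)%:E <= accept_prob A x)%E) /\
    (forall x : seq sigma3, ~~ L5 x -> ((4 / 7 : RR)%:E <= reject_prob A x)%E).
Proof.
exists A5; split; [exact: A5_QPA | split=> x Lx].
  (* Among the first [size x + 2] terms, the one at index [0] gives [3 / 7] and the last one
     [1 / 7]. *)
  apply: le_trans (partial_sum_le _ (size x).+2 (p_acc_step_ge0 x)).
  rewrite lee_fin big_nat_recl // big_nat_recr //=.
  have s0 : 0 <= \sum_(0 <= i < size x) p_acc_step A5 x i.+1.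
    by apply: sumr_ge0 => i _; exact: p_acc_step_ge0.
  have := p_acc_step0 x; have := p_acc_step_end x Lx; lra.
apply: le_trans (partial_sum_le _ (size x).+2 (p_rej_step_ge0 x)).
rewrite lee_fin big_nat_recr //=.
have s0 : 0 <= \sum_(0 <= i < (size x).+1) p_rej_step A5 x i.
  by apply: sumr_ge0 => i _; exact: p_rej_step_ge0.
have := p_rej_step_end x Lx; lra.
Qed.
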